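(* Let $\mathcal{P} = \langle \mathcal{S} \mid \mathcal{R} \rangle$ be a finite homogeneous positive presentation of a group $G$ such that every relation in $\mathcal{R}$ is Hurwitz-compatible. Let $\mathbf{a},\mathbf{a}'$ be generator $G$-systems of the same length. (1) If $W(\mathbf{a}) \equiv W(\mathbf{a}')$, then $\mathbf{a} \sim_{H} \mathbf{a}'$. (2) If $W(\mathbf{a})^{-1}W(\mathbf{a}') \curvearrowright \varepsilon$, then $\mathbf{a} \sim_{H} \mathbf{a}'$. Moreover, in this case the Hurwitz search problem for $\mathbf{a}$ and $\mathbf{a}'$ can be solved: there is an algorithm which, for every such pair $(\mathbf{a},\mathbf{a}')$ of length $m$, outputs a braid $\beta\in B_m$ with $\mathbf{a}\cdot\beta=\mathbf{a}'$. (3) If the natural map $M_{\mathcal{P}}^{+}\to G$ is injective, then $\mathbf{a} \sim_{H} \mathbf{a}'$ if and only if $C(\mathbf{a}) = C(\mathbf{a}')$. (4) If the natural map $M_{\mathcal{P}}^{+}\to G$ is injective and the presentation $\mathcal{P}$ is complete, then $\mathbf{a} \sim_{H} \mathbf{a}'$ if and only if $W(\mathbf{a})^{-1}W(\mathbf{a}') \curvearrowright \varepsilon$. In this case both the Hurwitz equivalence problem and the Hurwitz search problem can be solved for generator $G$-systems: there is an algorithm which decides whether two given generator $G$-systems of the same length $m$ are Hurwitz equivalent and, if they are, outputs a braid $\beta\in B_m$ carrying the first to the second.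
   Context: Positive presentations. Let $\mathcal{S}$ be a set and $\mathcal{S}^*$ the free monoid on $\mathcal{S}$; $l(V)$ is the length of $V\in\mathcal{S}^*$, and $\varepsilon$ is the empty word. A positive relation is a pair of words $V,W\in \mathcal{S}^*$, written $V\equiv W$ (it may be used in either direction); it is homogeneous if $l(V)=l(W)$. A positive presentation of a group $G$ is a group presentation $\mathcal{P}=\langle \mathcal{S}\mid\mathcal{R}\rangle$ where $\mathcal{R}$ is a set of positive relations, $V\equiv W$ being read as the group relation $V^{-1}W=1$. It is finite if $\mathcal{S}$ and $\mathcal{R}$ are finite, and homogeneous if all its relations are. The associated monoid is $M^+_{\mathcal{P}}=\mathcal{S}^*/\!\equiv$, where $\equiv$ is the smallest congruence on $\mathcal{S}^*$ containing $\mathcal{R}$; there is a natural monoid homomorphism $M^+_{\mathcal{P}}\to G$. Word reversing. For words $W,W'$ on $\mathcal{S}\cup\mathcal{S}^{-1}$ (not freely reduced), $W'$ is obtained from $W$ by one word reversing if either (i) a subword $u^{-1}v$ of $W$, with $u,v$ nonempty words on $\mathcal{S}$, is replaced by $u'v'^{-1}$, where $u',v'$ are (possibly empty) words on $\mathcal{S}$ such that $uu'\equiv vv'$ is a relation in $\mathcal{R}$; or (ii) a subword $u^{-1}u$, with $u$ a nonempty word on $\mathcal{S}$, is deleted. Write $W\curvearrowright W'$ if $W'$ is obtained from $W$ by iterated word reversings. The presentation is complete if for all $u,v\in\mathcal{S}^*$, $u^{-1}v\curvearrowright\varepsilon$ is equivalent to $u\equiv v$. Hurwitz action. A $G$-system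 of length $m$ is an element of $G^m$. A generator $G$-system of length $m$ is an element of $\mathcal{S}^m$, regarded as a $G$-system via $\mathcal{S}\to G$. The braid group $B_m$, with standard generators $\sigma_1,\dots,\sigma_{m-1}$, acts on $G^m$ from the right by $(g_1,\dots,g_m)\cdot\sigma_i=(g_1,\dots,g_{i-1},g_{i+1},g_{i+1}^{-1}g_ig_{i+1},g_{i+2},\dots,g_m)$. Two $G$-systems are Hurwitz equivalent, written $\sim_H$, if they are in the same $B_m$-orbit. The Hurwitz equivalence problem asks to decide whether two given $G$-systems are Hurwitz equivalent; the Hurwitz search problem asks, given two Hurwitz equivalent $G$-systems $\mathbf{g},\mathbf{g}'$, to find a braid $\beta$ with $\mathbf{g}\cdot\beta=\mathbf{g}'$. For $\mathbf{a}=(a_1,\dots,a_m)\in\mathcal{S}^m$, the Coxeter word is $W(\mathbf{a})=a_1a_2\cdots a_m\in\mathcal{S}^*$ and the Coxeter element is $C(\mathbf{a})=a_1a_2\cdots a_m\in G$. Hurwitz-compatibility. A homogeneous positive relation $V\equiv W$ with $V=a_1\cdots a_l$ and $W=a'_1\cdots a'_l$ ($a_i,a_i'\in\mathcal{S}$) is Hurwitz-compatible if there is a braid $\beta\in B_l$ with $(a_1,\dots,a_l)\cdot\beta=(a'_1,\dots,a'_l)$ in $G^l$. *)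

(* Defs.v *)
From HB Require Import structures.
From Stdlib Require Import Relation_Operators.
From mathcomp Require Import all_boot zify.
From mathcomp Require Import boolp.

Set Implicit Arguments.
Unset Strict Implicit.
Unset Printing Implicit Defensive.

Local Open Scope group_scope.
Local Open Scope quotient_scope.

(* Smallest congruence on the free monoid [seq T] containing [r]. *)
Inductive congr (T : Type) (r : seq T -> seq T -> Prop) :
    seq T -> seq T -> Prop :=
| congr_rel u v of r u v : congr r u v
| congr_refl u : congr r u u
| congr_sym u v of congr r u v : congr r v u
| congr_trans v u w of congr r u v & congr r v w : congr r u w
| congr_cat u u' v v' of congr r u u' & congr r v v' :
    congr r (u ++ v) (u' ++ v').

Section PresentedMonoid.
Variables (T : choiceType) (r : seq T -> seq T -> Prop).

Definition congrb : rel (seq T) := fun u v => `[< congr r u v >].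

Lemma congrb_refl : reflexive congrb.
Proof. by move=> u; apply/asboolP/congr_refl. Qed.

Lemma congrb_sym : symmetric congrb.
Proof. by move=> u v; apply/asboolP/asboolP => /congr_sym. Qed.

Lemma congrb_trans : transitive congrb.
Proof.
move=> v u w /asboolP uv /asboolP vw; apply/asboolP; exact: congr_trans uv vw.
Qed.

Canonical congr_equiv := EquivRel congrb congrb_refl congrb_sym congrb_trans.

Definition pres_monoid := {eq_quot congr_equiv}.
HB.instance Definition _ := Choice.on pres_monoid.
HB.instance Definition _ := EqQuotient.on pres_monoid.

Definition word_class (u : seq T) : pres_monoid := \pi_pres_monoid u.

Lemma word_classP u v : word_class u = word_class v <-> congr r u v.
Proof.
split=> [/eqP|h]; first by rewrite /word_class piE => /asboolP.
by apply/eqP; rewrite /word_class piE; apply/asboolP.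
Qed.

Lemma congr_repr u : congr r (repr (word_class u)) u.
Proof. by apply/word_classP; rewrite /word_class reprK. Qed.

Lemma word_classK (x : pres_monoid) : word_class (repr x) = x.
Proof. exact: reprK. Qed.

Definition pres_mul (x y : pres_monoid) : pres_monoid :=
  word_class (repr x ++ repr y).
Definition pres_one : pres_monoid := word_class [::].

Lemma pres_mul_class u v :
  pres_mul (word_class u) (word_class v) = word_class (u ++ v).
Proof. by apply/word_classP; apply: congr_cat; exact: congr_repr. Qed.

Lemma pres_mulA : associative pres_mul.
Proof.
move=> x y z; rewrite -(word_classK x) -(word_classK y) -(word_classK z).
by rewrite !pres_mul_class catA.
Qed.

Lemma pres_mul1 : left_id pres_one pres_mul.
Proof. by move=> x; rewrite -(word_classK x) pres_mul_class. Qed.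

Lemma pres_mulr1 : right_id pres_one pres_mul.
Proof. by move=> x; rewrite -(word_classK x) pres_mul_class cats0. Qed.

HB.instance Definition _ :=
  isMonoid.Build pres_monoid pres_mulA pres_mul1 pres_mulr1.

End PresentedMonoid.

(* The letter [(s, false)] stands for s and [(s, true)] for its inverse. *)
Notation signed T := (T * bool)%type.

Definition pos_word (T : Type) (u : seq T) : seq (signed T) :=
  [seq (s, false) | s <- u].

Definition inv_letter (T : Type) (x : signed T) : signed T := (x.1, ~~ x.2).

Definition inv_word (T : Type) (w : seq (signed T)) : seq (signed T) :=
  rev (map (@inv_letter T) w).

(* Relations on signed words whose congruence is equality in the group
   presented by [r]: the positive relations, and the cancellation of a letter
   against its inverse, in both orders. *)
Inductive group_rel (T : Type) (r : seq T -> seq T -> Prop) :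
    seq (signed T) -> seq (signed T) -> Prop :=
| group_rel_pos u v of r u v : group_rel r (pos_word u) (pos_word v)
| group_rel_inv x : group_rel r [:: x; inv_letter x] [::].

Lemma inv_letterK T : involutive (@inv_letter T).
Proof. by case=> s b; rewrite /inv_letter /= negbK. Qed.

Section PresentedGroup.
Variables (T : choiceType) (r : seq T -> seq T -> Prop).

Definition pres_group : Type := pres_monoid (group_rel r).
HB.instance Definition _ := Monoid.on pres_group.

Lemma inv_word_cat T' (u v : seq (signed T')) :
  inv_word (u ++ v) = inv_word v ++ inv_word u.
Proof. by rewrite /inv_word map_cat rev_cat. Qed.

Lemma inv_wordK T' : involutive (@inv_word T').
Proof.
move=> w; rewrite /inv_word map_rev revK -map_comp.
by rewrite (eq_map (@inv_letterK T')) map_id.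
Qed.

Lemma congr_mulV w : congr (group_rel r) (w ++ inv_word w) [::].
Proof.
elim: w => [|x w IH]; first exact: congr_refl.
rewrite -[x :: w]/([:: x] ++ w) inv_word_cat -catA.
apply: (congr_trans (v := [:: x] ++ [::] ++ inv_word [:: x])).
  apply: congr_cat; first exact: congr_refl.
  by rewrite catA; apply: congr_cat IH _; exact: congr_refl.
by apply: congr_rel; exact: group_rel_inv.
Qed.

Lemma congr_mulV_uniq u v : congr (group_rel r) u v ->
  congr (group_rel r) (inv_word u) (inv_word v).
Proof.
move=> uv; apply: (congr_trans (v := inv_word u ++ v ++ inv_word v)).
  rewrite -[X in congr _ X _]cats0; apply: congr_cat; first exact: congr_refl.
  exact/congr_sym/congr_mulV.
rewrite catA -[X in congr _ _ X]cat0s; apply: congr_cat (congr_refl _ _).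
apply: (congr_trans (v := inv_word u ++ inv_word (inv_word u))).
  by rewrite inv_wordK; apply: congr_cat (congr_refl _ _) _; exact: congr_sym.
exact: congr_mulV.
Qed.

Definition pres_inv (x : pres_group) : pres_group :=
  word_class (group_rel r) (inv_word (repr x)).

Lemma pres_mulV (x : pres_group) : x * pres_inv x = 1.
Proof.
rewrite -[X in X * _]word_classK [LHS]pres_mul_class.
by apply/word_classP; exact: congr_mulV.
Qed.

Lemma pres_Vmul (x : pres_group) : pres_inv x * x = 1.
Proof.
rewrite -[X in _ * X]word_classK [LHS]pres_mul_class; apply/word_classP.
by rewrite -[X in _ ++ X]inv_wordK; exact: congr_mulV.
Qed.

HB.instance Definition _ := hasInv.Build pres_group pres_inv.
HB.instance Definition _ := Monoid_isGroup.Build pres_group pres_Vmul pres_mulV.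

End PresentedGroup.

Section PositivePresentation.
Variables (S : finType) (R : seq (seq S * seq S)) (G : groupType).
Variable iota : S -> G.

Definition relator (u v : seq S) : Prop := (u, v) \in R.

Definition letter_val (x : signed S) : G :=
  if x.2 then (iota x.1)^-1 else iota x.1.

(* G is generated by the image of S, and two signed words have the same value
   in G exactly when the relations of R and free cancellation identify them. *)
Definition presents : Prop :=
  (forall g : G, exists w : seq (signed S), \prod_(x <- w) letter_val x = g) /\
  (forall w w' : seq (signed S),
     \prod_(x <- w) letter_val x = \prod_(x <- w') letter_val x
     <-> congr (group_rel relator) w w').

Definition homogeneous : Prop :=
  forall u v : seq S, relator u v -> size u = size v.

Definition equivp (u v : seq S) : Prop := congr relator u v.

(* Evaluated on a chosen representative word; [nat_map_class] and [nat_mapM]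
   show that this is the canonical monoid morphism. *)
Definition nat_map (x : pres_monoid relator) : G := \prod_(s <- repr x) iota s.

Lemma pos_word_val (u : seq S) :
  \prod_(x <- pos_word u) letter_val x = \prod_(s <- u) iota s.
Proof. by rewrite big_map. Qed.

Lemma equivp_val (u v : seq S) : presents -> equivp u v ->
  \prod_(s <- u) iota s = \prod_(s <- v) iota s.
Proof.
move=> [_ pres]; elim=> // {u v}.
- move=> u v uv; rewrite -!pos_word_val; apply/pres.
  by apply: congr_rel; exact: group_rel_pos.
- by move=> v u w _ -> _ ->.
- by move=> u u' v v' _ e _ e'; rewrite !big_cat /= e e'.
Qed.

Lemma nat_map_class (u : seq S) : presents ->
  nat_map (word_class relator u) = \prod_(s <- u) iota s.
Proof. by move=> pres; apply: equivp_val => //; exact: congr_repr. Qed.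

Lemma nat_mapM : presents -> {morph nat_map : x y / x * y}.
Proof.
move=> pres x y; rewrite -(word_classK x) -(word_classK y).
rewrite [X in nat_map X]pres_mul_class !nat_map_class //.
by rewrite big_cat.
Qed.

(* A pair of R may be used in either direction; u' and v' may be empty. *)
Inductive rev_step : seq (signed S) -> seq (signed S) -> Prop :=
| rev_step_rel x y u v u' v' of u != [::] & v != [::] &
    relator (u ++ u') (v ++ v') \/ relator (v ++ v') (u ++ u') :
    rev_step (x ++ (inv_word (pos_word u) ++ pos_word v) ++ y)
             (x ++ (pos_word u' ++ inv_word (pos_word v')) ++ y)
| rev_step_del x y u of u != [::] :
    rev_step (x ++ (inv_word (pos_word u) ++ pos_word u) ++ y) (x ++ y).

Definition reverses : seq (signed S) -> seq (signed S) -> Prop :=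
  clos_refl_trans _ rev_step.

(* The signed word u^-1 v, not freely reduced. *)
Definition quot_word (u v : seq S) : seq (signed S) :=
  inv_word (pos_word u) ++ pos_word v.

Definition complete : Prop :=
  forall u v : seq S, reverses (quot_word u v) [::] <-> equivp u v.

End PositivePresentation.

(* Strands and generators are numbered from 0: the ordinal [i : 'I_m.-1] is
   the standard generator crossing the strands [i] and [i.+1]. *)
Inductive braid_rel (m : nat) : seq 'I_m.-1 -> seq 'I_m.-1 -> Prop :=
| braid_far (i j : 'I_m.-1) of (i.+1 < j)%N : braid_rel [:: i; j] [:: j; i]
| braid_near (i j : 'I_m.-1) of j = i.+1 :> nat :
    braid_rel [:: i; j; i] [:: j; i; j].

Notation braid_word m := (seq (signed 'I_m.-1)).

Definition braid_group (m : nat) : groupType := pres_group (@braid_rel m).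

Definition braid_of (m : nat) (w : braid_word m) : braid_group m :=
  word_class (group_rel (@braid_rel m)) w.

Section HurwitzAction.
Variables (G : groupType) (m : nat).
Implicit Types (g : m.-tuple G) (i : 'I_m.-1).

Definition hurwitz_sigma g i : m.-tuple G :=
  [tuple if j == i :> nat then nth 1 g i.+1
         else if j == i.+1 :> nat
              then (nth 1 g i.+1)^-1 * nth 1 g i * nth 1 g i.+1
         else nth 1 g j | j < m].

Definition hurwitz_sigmaV g i : m.-tuple G :=
  [tuple if j == i :> nat then nth 1 g i * nth 1 g i.+1 * (nth 1 g i)^-1
         else if j == i.+1 :> nat then nth 1 g i
         else nth 1 g j | j < m].

Definition hurwitz_letter g (x : signed 'I_m.-1) : m.-tuple G :=
  if x.2 then hurwitz_sigmaV g x.1 else hurwitz_sigma g x.1.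

Definition hurwitz_word g (w : braid_word m) : m.-tuple G :=
  foldl hurwitz_letter g w.

(* Evaluated on a chosen representative braid word; by [hurwitz_act_class],
   [hurwitz_act1] and [hurwitz_actM] this is a right action of the group. *)
Definition hurwitz_act g (b : braid_group m) : m.-tuple G :=
  hurwitz_word g (repr b).

Definition hurwitz_equiv g g' : Prop :=
  exists b : braid_group m, hurwitz_act g b = g'.

Lemma nth_mktuple_gen (F : nat -> G) k : (k < m)%N ->
  nth 1 [tuple F j | j < m] k = F k.
Proof. by move=> km; rewrite -[k]/(val (Ordinal km)) -tnth_nth tnth_mktuple. Qed.

Lemma nth_sigma g i k : nth 1 (hurwitz_sigma g i) k =
  if k == i then nth 1 g i.+1
  else if k == i.+1 then (nth 1 g i.+1)^-1 * nth 1 g i * nth 1 g i.+1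
  else nth 1 g k.
Proof.
case: (ltnP k m) => km.
  by rewrite (nth_mktuple_gen (fun j : nat => if j == i then _ else
    if j == i.+1 then _ else nth 1 g j)).
have im := ltn_ord i.
rewrite nth_default ?size_tuple// [nth 1 g k]nth_default ?size_tuple//.
by rewrite !ifN//; lia.
Qed.

Lemma nth_sigmaV g i k : nth 1 (hurwitz_sigmaV g i) k =
  if k == i then nth 1 g i * nth 1 g i.+1 * (nth 1 g i)^-1
  else if k == i.+1 then nth 1 g i
  else nth 1 g k.
Proof.
case: (ltnP k m) => km.
  by rewrite (nth_mktuple_gen (fun j : nat => if j == i then _ else
    if j == i.+1 then _ else nth 1 g j)).
have im := ltn_ord i.
rewrite nth_default ?size_tuple// [nth 1 g k]nth_default ?size_tuple//.
by rewrite !ifN//; lia.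
Qed.

Lemma tuple_eqP g g' : (forall k, nth 1 g k = nth 1 g' k) -> g = g'.
Proof. by move=> e; apply: eq_from_tnth => j; rewrite !(tnth_nth 1). Qed.

Lemma hurwitz_sigmaK g i : hurwitz_sigmaV (hurwitz_sigma g i) i = g.
Proof.
apply: tuple_eqP => k; rewrite nth_sigmaV !nth_sigma !eqxx.
rewrite (gtn_eqF (ltnSn i)); case: eqP => [->|_].
  by rewrite !mulgA mulgV mul1g mulgK.
by case: eqP => [->|].
Qed.

Lemma hurwitz_sigmaVK g i : hurwitz_sigma (hurwitz_sigmaV g i) i = g.
Proof.
apply: tuple_eqP => k; rewrite nth_sigma !nth_sigmaV !eqxx.
rewrite (gtn_eqF (ltnSn i)); case: eqP => [->//|_].
by case: eqP => [->|//]; rewrite !mulgA mulVg mul1g mulgVK.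
Qed.

Lemma hurwitz_far g i (j : 'I_m.-1) : (i.+1 < j)%N ->
  hurwitz_sigma (hurwitz_sigma g i) j = hurwitz_sigma (hurwitz_sigma g j) i.
Proof.
move=> ij; apply: tuple_eqP => k; rewrite !nth_sigma.
by repeat case: ifP => ?; try lia.
Qed.

Lemma hurwitz_near g i (j : 'I_m.-1) : j = i.+1 :> nat ->
  hurwitz_sigma (hurwitz_sigma (hurwitz_sigma g i) j) i =
  hurwitz_sigma (hurwitz_sigma (hurwitz_sigma g j) i) j.
Proof.
move=> ij; apply: tuple_eqP => k; rewrite !nth_sigma !ij !eqxx.
rewrite !(gtn_eqF (ltnSn _)) !(ltn_eqF (ltnSn _)).
rewrite !(gtn_eqF (ltnW (ltnSn _))) !(ltn_eqF (ltnW (ltnSn _))).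
by repeat case: ifP => ?; try lia; rewrite // !invgM !mulgA ?mulgK ?mulgVK.
Qed.

Lemma hurwitz_word_cat g (u v : braid_word m) :
  hurwitz_word g (u ++ v) = hurwitz_word (hurwitz_word g u) v.
Proof. exact: foldl_cat. Qed.

Lemma hurwitz_word_congr (u v : braid_word m) :
  congr (group_rel (@braid_rel m)) u v ->
  forall g, hurwitz_word g u = hurwitz_word g v.
Proof.
elim=> {u v} [u v []||u v _ IH g|v u w _ IHu _ IHv g|u u' v v' _ IHu _ IHv g] //.
- move=> {u v} u v [i j ij|i j ij] g; first exact: hurwitz_far.
  exact: hurwitz_near.
- move=> [i []] g; first exact: hurwitz_sigmaVK.
  exact: hurwitz_sigmaK.
- by rewrite IHu.
- by rewrite !hurwitz_word_cat IHu IHv.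
Qed.

Lemma hurwitz_act_class g (w : braid_word m) :
  hurwitz_act g (braid_of w) = hurwitz_word g w.
Proof. exact/hurwitz_word_congr/congr_repr. Qed.

Lemma hurwitz_act1 g : hurwitz_act g 1 = g.
Proof. exact: (hurwitz_act_class g [::]). Qed.

Lemma hurwitz_actM g (b c : braid_group m) :
  hurwitz_act g (b * c) = hurwitz_act (hurwitz_act g b) c.
Proof.
rewrite [b * c](_ : _ = braid_of (repr b ++ repr c)) //.
by rewrite hurwitz_act_class hurwitz_word_cat.
Qed.

End HurwitzAction.

Section GeneratorSystems.
Variables (S : finType) (G : groupType) (iota : S -> G).

Definition gsys (m : nat) (a : m.-tuple S) : m.-tuple G := map_tuple iota a.

Definition hurwitz_compatible (r : seq S * seq S) : Prop :=
  exists (l : nat) (a a' : l.-tuple S),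
    r = (tval a, tval a') /\
    exists b : braid_group l, hurwitz_act (gsys a) b = gsys a'.

Definition coxeter_word (m : nat) (a : m.-tuple S) : seq S := a.

Definition coxeter_element (m : nat) (a : m.-tuple S) : G :=
  \prod_(i < m) iota (tnth a i).

End GeneratorSystems.

(* Graph of the function defined by primitive recursion from the partial
   functions with graphs [f] and [g]: h(0, x) = f(x) and
   h(n+1, x) = g(n, h(n, x), x). *)
Fixpoint primrec_graph (k : nat) (f : k.-tuple nat -> nat -> Prop)
    (g : k.+2.-tuple nat -> nat -> Prop) (n : nat) (x : k.-tuple nat) (y : nat)
    : Prop :=
  if n is n'.+1
  then exists2 z, primrec_graph f g n' x z & g [tuple of n' :: z :: x] y
  else f x y.

(* Kleene's partial recursive functions, each represented by its graph:
   [F x y] means that the function is defined at [x], with value [y]. *)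
Inductive partial_recursive :
    forall k : nat, (k.-tuple nat -> nat -> Prop) -> Prop :=
| PR_zero : @partial_recursive 0 (fun _ y => y = 0%N)
| PR_succ : @partial_recursive 1 (fun x y => y = (thead x).+1)
| PR_proj k (i : 'I_k) : @partial_recursive k (fun x y => y = tnth x i)
| PR_comp k l (f : l.-tuple nat -> nat -> Prop)
    (g : 'I_l -> k.-tuple nat -> nat -> Prop) of
    partial_recursive f & (forall i, partial_recursive (g i)) :
    @partial_recursive k (fun x y =>
      exists2 z : l.-tuple nat, (forall i, g i x (tnth z i)) & f z y)
| PR_primrec k (f : k.-tuple nat -> nat -> Prop)
    (g : k.+2.-tuple nat -> nat -> Prop) of
    partial_recursive f & partial_recursive g :
    @partial_recursive k.+1 (fun x y =>
      primrec_graph f g (thead x) [tuple of behead x] y)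
| PR_mu k (f : k.+1.-tuple nat -> nat -> Prop) of partial_recursive f :
    @partial_recursive k (fun x y =>
      f [tuple of y :: x] 0%N /\
      forall z, (z < y)%N -> exists2 v, f [tuple of z :: x] v & v <> 0%N).

Lemma partial_recursive_functional k (F : k.-tuple nat -> nat -> Prop) :
  partial_recursive F -> forall x y y', F x y -> F x y' -> y = y'.
Proof.
elim=> {k F} [x y y' -> ->|x y y' -> ->|k i x y y' -> ->|k l f g _ IHf _ IHg|
              k f g _ IHf _ IHg|k f _ IH] //.
- move=> x y y' [z zg zf] [z' zg' zf'].
  have e : z = z' by apply: eq_from_tnth => i; exact: IHg (zg i) (zg' i).
  by rewrite -e in zf'; exact: IHf zf zf'.
- move=> x; move: [tuple of behead x] => t; elim: (thead x) => [|n IHn] y y' /=.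
    exact: IHf.
  move=> [z nz zy] [z' nz' zy'].
  by rewrite -(IHn _ _ nz nz') in zy'; exact: IHg zy zy'.
- move=> x y y' [fy ymin] [fy' ymin']; case: (ltngtP y y') => // lt.
    by have [v fv []] := ymin' _ lt; exact: IH fv fy.
  by have [v fv []] := ymin _ lt; exact: IH fv fy'.
Qed.

(* [pickle] numbers words effectively: a letter is sent to a number (its value
   when it is an ordinal) and a list to the Goedel code [CodeSeq.code] of the
   numbers of its entries; pairs and options are coded as lists. *)
Definition pair_code (S : finType) (m : nat) (a a' : m.-tuple S) :
    2.-tuple nat :=
  [tuple pickle (tval a); pickle (tval a')].

(* Main.v *)
From Stdlib Require Import Relation_Operators.
Require Import Defs.
From mathcomp Require Import all_boot zify.
From mathcomp Require Import boolp.

(** The Hurwitz action is local: a braid on [l] strands that carries [u] to [v]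
    carries [p ++ u ++ q] to [p ++ v ++ q] once its strands are shifted by the
    length of [p] ([hurwitz_seq_block]).  Compatibility of the relations thus
    attaches a braid to each rewriting of a word by a relation, and a chain of
    rewritings from [W(a)] to [W(a')] yields, by concatenation, a braid from
    [a] to [a'].

    Reversing is sound without any embedding of the monoid in a group.  A
    signed word is read as a walk in the Cayley graph of the monoid, a positive
    letter multiplying on the right and a negative letter undoing such a
    multiplication.  One reversing step keeps the endpoints of the walks that
    the word describes ([joined_step]); the word [u^-1 v] describes a walk from
    [u] to [v] through [1], and the empty word only describes walks between
    equal elements, so that [u^-1 v] reverses to the empty word only if [u] and
    [v] are equivalent ([reverses_equivp]).  Conversely the Hurwitz action
    preserves the product of a system, so if the monoid embeds in [G],
    Hurwitz equivalent systems have equivalent Coxeter words.  Everything is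
    thereby reduced to equivalence of positive words.

    Equivalence of two words of length [m] is decidable because homogeneity
    confines the chain of rewritings to the finite set of words of length [m]:
    a shortest chain has fewer than [#|S| ^ m] steps, each described by a
    position and the index of a rule.  The algorithm [find_braid] numbers all
    lists of such instructions, tries them up to an explicit bound that exceeds
    the number of some list of that length, and accumulates the shifted
    braids along the way.  Since each tried list can only produce a braid that
    carries the first system to the word reached ([carries_run]), a success is
    always correct; the bound gives the completeness ([find_braid_complete]).

    To see that this algorithm is partial recursive, Kleene's functions are
    first shown to contain the numerical functions needed to build and take
    apart the codes of lists; the unbounded search is used once, to extract
    the head of a list.  A function between countable types is then called
    computable when a recursive function does the same on codes, and the
    computable functions are shown to be closed under iteration, case analysis
    and folding on lists, and finally under bounded search. *)

Set Implicit Arguments.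
Unset Strict Implicit.
Unset Printing Implicit Defensive.

(** * Total recursive functions *)

Definition total_recursive k (f : k.-tuple nat -> nat) : Prop :=
  partial_recursive (fun x y => y = f x).

Lemma graph_recursive k (F : k.-tuple nat -> nat -> Prop) f :
  partial_recursive F -> (forall x y, F x y <-> y = f x) -> total_recursive f.
Proof.
move=> Frec Ff; rewrite /total_recursive (_ : (fun x y => y = f x) = F) //.
by apply/funext => x; apply/funext => y; apply/propext; split=> /Ff.
Qed.

Lemma total_recursive_proj k (i : 'I_k) :
  total_recursive (fun x : k.-tuple nat => tnth x i).
Proof. exact: PR_proj. Qed.

Lemma total_recursive_comp k l (f : l.-tuple nat -> nat)
    (g : 'I_l -> k.-tuple nat -> nat) :
  total_recursive f -> (forall i, total_recursive (g i)) ->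
  total_recursive (fun x => f [tuple g i x | i < l]).
Proof.
move=> frec grec; apply: graph_recursive (PR_comp frec grec) _ => x y.
split=> [[z zg ->]|->].
  by congr f; apply: eq_from_tnth => i; rewrite zg tnth_mktuple.
by exists [tuple g i x | i < l] => // i; rewrite tnth_mktuple.
Qed.

Lemma total_recursive_primrec k (f : k.-tuple nat -> nat)
    (g : k.+2.-tuple nat -> nat) :
  total_recursive f -> total_recursive g ->
  total_recursive (fun x : k.+1.-tuple nat =>
    nat_rect (fun=> nat) (f [tuple of behead x])
      (fun n z => g [tuple of n :: z :: [tuple of behead x]]) (thead x)).
Proof.
move=> frec grec; apply: graph_recursive (PR_primrec frec grec) _ => x.
elim: (thead x) => [|n IHn] y //=.
split=> [[z /IHn -> ->]//|->].
by eexists; [apply/IHn|].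
Qed.

(** The graph form of minimisation asks for values at all the arguments below
    the minimum, which a total [f] has for free. *)
Lemma total_recursive_mu k (f : k.+1.-tuple nat -> nat)
    (mu : k.-tuple nat -> nat) :
  total_recursive f ->
  (forall x, f [tuple of mu x :: x] = 0) ->
  (forall x z, z < mu x -> f [tuple of z :: x] <> 0) ->
  total_recursive mu.
Proof.
move=> frec mu0 mumin; apply: graph_recursive (PR_mu frec) _ => x y.
split=> [[fy ymin]|->].
  case: (ltngtP y (mu x)) => // lt; first by case: (mumin _ _ lt).
  by have [v -> []] := ymin _ lt; rewrite mu0.
split=> // z zlt; exists (f [tuple of z :: x]) => //; exact: mumin.
Qed.

Definition recursive (f : nat -> nat) : Prop :=
  total_recursive (fun x : 1.-tuple nat => f (thead x)).

Definition recursive2 (f : nat -> nat -> nat) : Prop :=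
  total_recursive (fun x : 2.-tuple nat => f (tnth x ord0) (tnth x ord_max)).

Lemma total_recursive_app k f (g : k.-tuple nat -> nat) :
  recursive f -> total_recursive g -> total_recursive (fun x => f (g x)).
Proof.
move=> frec grec.
have := total_recursive_comp frec (fun=> grec); congr total_recursive.
by apply/funext => x; rewrite [thead _]tnth_mktuple.
Qed.

Lemma total_recursive_app2 k f (g h : k.-tuple nat -> nat) :
  recursive2 f -> total_recursive g -> total_recursive h ->
  total_recursive (fun x => f (g x) (h x)).
Proof.
move=> frec grec hrec.
have gh (i : 'I_2) : total_recursive (if i == ord0 then g else h) by case: ifP.
have := total_recursive_comp frec gh; congr total_recursive.
by apply/funext => x; rewrite !tnth_mktuple.
Qed.

Lemma recursive_id : recursive id.
Proof. exact: total_recursive_proj. Qed.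

Lemma recursive_comp f g : recursive f -> recursive g -> recursive (f \o g).
Proof. exact: total_recursive_app. Qed.

Lemma recursive_app2 h f g : recursive2 h -> recursive f -> recursive g ->
  recursive (fun n => h (f n) (g n)).
Proof. exact: total_recursive_app2. Qed.

Lemma recursive_succ : recursive succn.
Proof. exact: PR_succ. Qed.

Lemma total_recursive0 k : total_recursive (fun _ : k.-tuple nat => 0).
Proof.
have zero : total_recursive (fun _ : 0.-tuple nat => 0) := PR_zero.
by apply: (total_recursive_comp (g := fun _ _ => 0) zero) => -[].
Qed.

Lemma recursive_const c : recursive (fun=> c).
Proof.
elim: c => [|c IHc]; first exact: total_recursive0.
exact: recursive_comp recursive_succ IHc.
Qed.

(** The only use of primitive recursion with a parameter: iteration is the
    single recursion scheme from which the functions on lists are built. *)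
Lemma recursive2_iter f : recursive f -> recursive2 (fun n x => iter n f x).
Proof.
move=> frec; have arg : total_recursive (fun x : 3.-tuple nat =>
    f (tnth x (Ordinal (isT : 1 < 3)))).
  exact/total_recursive_app/total_recursive_proj.
have := total_recursive_primrec recursive_id arg; congr total_recursive.
apply/funext => x; rewrite -[thead x]/(tnth x ord0).
have -> : thead [tuple of behead x] = tnth x ord_max.
  by rewrite /thead !(tnth_nth 0) nth_behead.
by elim: (tnth x ord0) => //= n ->.
Qed.

Lemma recursive_rec c g : recursive2 g -> recursive (nat_rect (fun=> nat) c g).
Proof.
move=> grec; have czero : total_recursive (fun _ : 0.-tuple nat => c).
  exact: (total_recursive_app (recursive_const c) (total_recursive0 0)).
have arg : total_recursive (fun x : 2.-tuple nat =>
    g (tnth x ord0) (tnth x ord_max)) by [].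
exact: total_recursive_primrec czero arg.
Qed.

Lemma recursive2_fst f : recursive f -> recursive2 (fun m _ => f m).
Proof. by move=> frec; apply: total_recursive_app (total_recursive_proj _). Qed.

Lemma recursive2_snd f : recursive f -> recursive2 (fun _ n => f n).
Proof. by move=> frec; apply: total_recursive_app (total_recursive_proj _). Qed.

Lemma recursive_odd : recursive odd.
Proof.
have eq0_rec : recursive (fun n => n == 0).
  have := recursive_rec 1 (recursive2_fst (recursive_const 0)).
  by congr recursive; apply/funext => -[|n].
have := recursive_rec 0 (recursive2_snd eq0_rec); congr recursive.
by apply/funext; elim=> //= n ->; case: odd.
Qed.

Lemma recursive_half : recursive half.
Proof.
have g : recursive2 (fun n z => iter (odd n) succn z).
  exact: (total_recursive_app2 (recursive2_iter recursive_succ)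
    (recursive2_fst recursive_odd) (recursive2_snd recursive_id)).
have := recursive_rec 0 g; congr recursive.
by apply/funext; elim=> //= n ->; rewrite uphalf_half; case: odd.
Qed.

(** * Recursive operations on codes of lists *)

(** As [CodeSeq.code] is a bijection between lists of numbers and numbers, every
    number is the code of a list, either [0] for the empty list or
    [code_cons n c]. *)
Definition code_cons n c := 2 ^ n * c.*2.+1.
Definition code_head c := head 0 (CodeSeq.decode c).
Definition code_tail c := CodeSeq.code (behead (CodeSeq.decode c)).

Lemma code_consE n s : CodeSeq.code (n :: s) = code_cons n (CodeSeq.code s).
Proof. by []. Qed.

Lemma code_head_cons n c : code_head (code_cons n c) = n.
Proof.
by rewrite /code_head -[c]CodeSeq.decodeK -code_consE CodeSeq.codeK.
Qed.

Lemma code_tail_cons n c : code_tail (code_cons n c) = c.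
Proof.
by rewrite /code_tail -{1}[c]CodeSeq.decodeK -code_consE CodeSeq.codeK
  CodeSeq.decodeK.
Qed.

Lemma code_eq0_or_cons c : c = 0 \/ c = code_cons (code_head c) (code_tail c).
Proof.
rewrite -[c]CodeSeq.decodeK /code_head /code_tail CodeSeq.codeK.
by case: (CodeSeq.decode c) => [|n s]; [left|right].
Qed.

Lemma iter_double n c : iter n double c = 2 ^ n * c.
Proof. by elim: n => [|n /= ->]; rewrite ?mul1n // expnS -mulnA mul2n. Qed.

Lemma iter_half_code_cons m n c :
  iter m half (code_cons (m + n) c) = code_cons n c.
Proof.
elim: m n => [//|m IHm] n /=; rewrite addSnnS IHm /code_cons expnS -mulnA.
by rewrite mul2n doubleK.
Qed.

(** The head of a list is the 2-adic valuation of its code. *)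
Lemma odd_iter_half m n c : m <= n ->
  odd (iter m half (code_cons n c)) = (m == n).
Proof.
move=> mn; rewrite -{1}(subnKC mn) iter_half_code_cons.
by rewrite oddM oddX /= odd_double andbT orbF subn_eq0 eqn_leq mn.
Qed.

Lemma code_cons_neq0 n c : code_cons n c <> 0.
Proof. by apply/eqP; rewrite muln_eq0 expn_eq0. Qed.

Lemma recursive2_code_cons : recursive2 code_cons.
Proof.
have double_rec : recursive double.
  have two : recursive (iter 2 succn).
    exact: recursive_comp recursive_succ recursive_succ.
  have := recursive_app2 (recursive2_iter two) recursive_id (recursive_const 0).
  by congr recursive; apply/funext; elim=> //= n ->.
have := total_recursive_app2 (recursive2_iter double_rec)
  (recursive2_fst recursive_id)
  (recursive2_snd (recursive_comp recursive_succ double_rec)).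
by congr total_recursive; apply/funext => x; rewrite /= iter_double.
Qed.

(** The valuation is the least [n] for which halving [n] times gives an odd
    number.  The minimised test vanishes at such an [n], and identically when
    the code is [0], so that the head of the empty list is [0]. *)
Lemma recursive_code_head : recursive code_head.
Proof.
have half_odd : recursive2 (fun n c => odd (iter n half c)).
  exact: total_recursive_app recursive_odd (recursive2_iter recursive_half).
have test : recursive2 (fun n c => iter (odd (iter n half c)) (fun=> 0) c).
  exact: total_recursive_app2 (recursive2_iter (recursive_const 0))
    half_odd (recursive2_snd recursive_id).
apply: (total_recursive_mu test) => [x|x z]; rewrite !(tnth_nth 0) /=.
  rewrite /thead (tnth_nth 0) /=.
  case: (code_eq0_or_cons (nth 0 x 0)) => [->|->]; first by case: odd.
  by rewrite code_head_cons odd_iter_half ?eqxx.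
rewrite /thead (tnth_nth 0) /=.
case: (code_eq0_or_cons (nth 0 x 0)) => [->//|->].
rewrite code_head_cons => zlt; rewrite odd_iter_half 1?ltnW// ltn_eqF//.
exact: code_cons_neq0.
Qed.

Lemma recursive_code_tail : recursive code_tail.
Proof.
have := recursive_comp recursive_half (recursive_app2
  (recursive2_iter recursive_half) recursive_code_head recursive_id).
congr recursive; apply/funext => c /=.
case: (code_eq0_or_cons c) => [->//|->].
rewrite code_head_cons code_tail_cons -{2}[code_head c]addn0.
by rewrite iter_half_code_cons /code_cons mul1n /= uphalf_double.
Qed.

Lemma recursive_cons f g : recursive f -> recursive g ->
  recursive (fun n => code_cons (f n) (g n)).
Proof. exact: recursive_app2 recursive2_code_cons. Qed.

Lemma recursive_iter h f g : recursive h -> recursive f -> recursive g ->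
  recursive (fun n => iter (f n) h (g n)).
Proof. by move=> /recursive2_iter; exact: recursive_app2. Qed.

(** The two branches are stored as a head and a tail.  Iterating [shift] as many
    times as the value of the test moves the tail to the head unless that value
    is [0], which avoids any recursion with two branches. *)
Lemma recursive_if0 t f g : recursive t -> recursive f -> recursive g ->
  recursive (fun n => if t n == 0 then f n else g n).
Proof.
move=> trec frec grec.
pose shift p := code_cons (code_tail p) (code_tail p).
have shiftr : recursive shift.
  by apply: recursive_cons; exact: recursive_code_tail.
have := recursive_comp recursive_code_head
  (recursive_iter shiftr trec (recursive_cons frec grec)).
congr recursive; apply/funext => n /=.
case: (t n) => [|k]; first by rewrite /= code_head_cons.
have -> : iter k.+1 shift (code_cons (f n) (g n)) = code_cons (g n) (g n).
  elim: k => [|k IHk]; [|rewrite iterS IHk].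
    by rewrite /= /shift code_tail_cons.
  by rewrite /shift code_tail_cons.
by rewrite code_head_cons.
Qed.

(** Two numbers are equal when the sum of both truncated differences is [0]. *)
Lemma recursive_if_eq s t f g :
  recursive s -> recursive t -> recursive f -> recursive g ->
  recursive (fun n => if s n == t n then f n else g n).
Proof.
move=> srec trec frec grec.
have predr : recursive predn.
  have := recursive_rec 0 (recursive2_fst recursive_id).
  by congr recursive; apply/funext => -[].
have subr u v : recursive u -> recursive v -> recursive (fun n => u n - v n).
  move=> urec vrec; have := recursive_iter predr vrec urec.
  congr recursive; apply/funext => n.
  by elim: (v n) => [|k /= ->]; rewrite ?subn0 // subnS.
have test : recursive (fun n => (s n - t n) + (t n - s n)).
  have := recursive_iter recursive_succ
    (subr _ _ srec trec) (subr _ _ trec srec).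
  by congr recursive; apply/funext => n; rewrite iter_succn addnC.
have := recursive_if0 test frec grec; congr recursive.
by apply/funext => n; rewrite addn_eq0 !subn_eq0 eqn_leq.
Qed.

(** * Computable functions between countable types *)

(** Nothing is asked of [g] at numbers that are not codes. *)
Definition computable (A B : countType) (f : A -> B) : Prop :=
  exists2 g, recursive g & forall a, g (pickle a) = pickle (f a).

(** A pair is coded like the list of the codes of its two components. *)
Definition code_pair m n := code_cons m (code_cons n 0).
Definition code_fst := code_head.
Definition code_snd c := code_head (code_tail c).

Lemma pickle_pair (A B : countType) (a : A) (b : B) :
  pickle (a, b) = code_pair (pickle a) (pickle b).
Proof. by []. Qed.

Lemma pickle_cons (A : countType) (a : A) (s : seq A) :
  pickle (a :: s) = code_cons (pickle a) (pickle s).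
Proof. by []. Qed.

Lemma code_fst_pair m n : code_fst (code_pair m n) = m.
Proof. exact: code_head_cons. Qed.

Lemma code_snd_pair m n : code_snd (code_pair m n) = n.
Proof. by rewrite /code_snd code_tail_cons code_head_cons. Qed.

Lemma recursive_pair f g : recursive f -> recursive g ->
  recursive (fun n => code_pair (f n) (g n)).
Proof.
move=> frec grec; apply: recursive_cons => //.
exact: recursive_cons (recursive_const 0).
Qed.

Lemma recursive_code_snd : recursive code_snd.
Proof. exact: recursive_comp recursive_code_head recursive_code_tail. Qed.

Implicit Types A B C X : countType.

Lemma computable_id X : computable (@id X).
Proof. by exists id => //; exact: recursive_id. Qed.

Lemma computable_const X A (a : A) : computable (fun _ : X => a).
Proof. by exists (fun=> pickle a) => //; exact: recursive_const. Qed.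

Lemma computable_app X A B (h : A -> B) (f : X -> A) :
  computable h -> computable f -> computable (fun x => h (f x)).
Proof.
move=> [h' hrec hE] [f' frec fE].
exists (h' \o f'); first exact: recursive_comp.
by move=> x; rewrite /= fE hE.
Qed.

Lemma computable_pair X A B (f : X -> A) (g : X -> B) :
  computable f -> computable g -> computable (fun x => (f x, g x)).
Proof.
move=> [f' frec fE] [g' grec gE].
exists (fun n => code_pair (f' n) (g' n)); first exact: recursive_pair.
by move=> x; rewrite pickle_pair fE gE.
Qed.

Lemma computable_app2 X A B C (h : A -> B -> C) (f : X -> A) (g : X -> B) :
  computable (fun p : A * B => h p.1 p.2) -> computable f -> computable g ->
  computable (fun x => h (f x) (g x)).
Proof.
move=> hc fc gc; exact: (computable_app hc (computable_pair fc gc)).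
Qed.

Lemma computable_fst X A B (f : X -> A * B) :
  computable f -> computable (fun x => (f x).1).
Proof.
apply: computable_app; exists code_fst; first exact: recursive_code_head.
by case=> a b; rewrite pickle_pair code_fst_pair.
Qed.

Lemma computable_snd X A B (f : X -> A * B) :
  computable f -> computable (fun x => (f x).2).
Proof.
apply: computable_app; exists code_snd; first exact: recursive_code_snd.
by case=> a b; rewrite pickle_pair code_snd_pair.
Qed.

Lemma computable_Some X A (f : X -> A) :
  computable f -> computable (fun x => Some (f x)).
Proof.
apply: computable_app; exists (fun n => code_cons n 0) => //.
exact: recursive_cons recursive_id (recursive_const 0).
Qed.

Lemma computable_cons X A (f : X -> A) (s : X -> seq A) :
  computable f -> computable s -> computable (fun x => f x :: s x).
Proof.
move=> [f' frec fE] [s' srec sE].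
exists (fun n => code_cons (f' n) (s' n)); first exact: recursive_cons.
by move=> x; rewrite pickle_cons fE sE.
Qed.

(** The context [x] is passed to the branch together with the head and tail:
    functions of several variables are represented as functions of tuples. *)
Lemma computable_seq_case X A B (s : X -> seq A) (f : X -> B)
    (g : X * (A * seq A) -> B) :
  computable s -> computable f -> computable g ->
  computable (fun x => if s x is a :: t then g (x, (a, t)) else f x).
Proof.
move=> [s' srec sE] [f' frec fE] [g' grec gE].
exists (fun n => if s' n == 0 then f' n else
    g' (code_pair n (code_pair (code_head (s' n)) (code_tail (s' n))))).
  apply: recursive_if0 => //; apply: recursive_comp (grec) _.
  apply: recursive_pair recursive_id _.
  apply: recursive_pair; apply: recursive_comp srec.
    exact: recursive_code_head.
  exact: recursive_code_tail.
move=> x; rewrite sE; case: (s x) => [|a t]; first by rewrite fE.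
rewrite pickle_cons ifN; last exact/eqP/code_cons_neq0.
by rewrite code_head_cons code_tail_cons -!pickle_pair gE.
Qed.

Lemma computable_eq X A (f g : X -> A) :
  computable f -> computable g -> computable (fun x => f x == g x).
Proof.
move=> [f' frec fE] [g' grec gE].
exists (fun n => if f' n == g' n then pickle true else pickle false).
  by apply: recursive_if_eq => //; exact: recursive_const.
by move=> x; rewrite fE gE (inj_eq (pcan_inj pickleK)) -fun_if; case: ifP.
Qed.

Lemma computable_if X A (b : X -> bool) (f g : X -> A) :
  computable b -> computable f -> computable g ->
  computable (fun x => if b x then f x else g x).
Proof.
move=> [b' brec bE] [f' frec fE] [g' grec gE].
exists (fun n => if b' n == pickle true then f' n else g' n).
  by apply: recursive_if_eq => //; exact: recursive_const.
by move=> x; rewrite bE (inj_eq (pcan_inj pickleK)) eqb_id fE gE; case: ifP.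
Qed.

Lemma computable_succ X (f : X -> nat) :
  computable f -> computable (fun x => (f x).+1).
Proof. by apply: computable_app; exists succn => //; exact: recursive_succ. Qed.

(** The code of a value is at hand for free, which provides numbers that are
    large enough to bound an iteration. *)
Lemma computable_pickle X A (f : X -> A) :
  computable f -> computable (fun x => pickle (f x)).
Proof. by move=> [f' frec fE]; exists f' => // x; rewrite fE. Qed.

Lemma computable_iter X A (n : X -> nat) (f : X * A -> A) (z : X -> A) :
  computable n -> computable f -> computable z ->
  computable (fun x => iter (n x) (fun a => f (x, a)) (z x)).
Proof.
move=> [n' nrec nE] [f' frec fE] [z' zrec zE].
pose step p := code_pair (code_fst p) (f' p).
have step_rec : recursive step.
  by apply: recursive_pair; first exact: recursive_code_head.
exists (fun m => code_snd (iter (n' m) step (code_pair m (z' m)))).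
  apply: recursive_comp recursive_code_snd _.
  exact: recursive_iter (recursive_pair recursive_id _).
move=> x; rewrite nE zE /=.
suff -> k : iter k step (code_pair (pickle x) (pickle (z x))) =
    code_pair (pickle x) (pickle (iter k (fun a => f (x, a)) (z x))).
  by rewrite code_snd_pair.
elim: k => // k IHk; rewrite iterS IHk /step code_fst_pair.
by rewrite -pickle_pair fE.
Qed.

(** Contexts are nested pairs, so most side conditions only concern the
    components of a tuple and are settled by the syntax of the function. *)
Ltac computability := repeat lazymatch goal with
  | |- @computable _ _ ?F => lazymatch F with
    | fun x => x => exact: computable_id
    | fst => exact: computable_fst (computable_id _)
    | snd => exact: computable_snd (computable_id _)
    | fun x => (@?f x).1 => apply: (@computable_fst _ _ _ f)
    | fun x => (@?f x).2 => apply: (@computable_snd _ _ _ f)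
    | fun x => (@?f x, @?g x) => apply: (@computable_pair _ _ _ f g)
    | fun x => @?f x :: @?g x => apply: (@computable_cons _ _ f g)
    | fun x => @?f x == @?g x => apply: (@computable_eq _ _ f g)
    | fun x => ?a => exact: computable_const
    end
  end.

(** A fold is an iteration of the step that consumes one entry.  The number of
    steps is the code of the list, which is at least its length; the empty list
    is a fixed point of the step, so the excess does no harm. *)
Lemma computable_foldl X A B (f : X * (B * A) -> B) (z : X -> B)
    (s : X -> seq A) :
  computable f -> computable z -> computable s ->
  computable (fun x => foldl (fun b a => f (x, (b, a))) (z x) (s x)).
Proof.
move=> fc zc sc.
pose step (p : X * (B * seq A)) :=
  if p.2.2 is a :: t then (f (p.1, (p.2.1, a)), t) else p.2.
have step_comp : computable step.
  have g_comp : computable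
      (fun q : (X * (B * seq A)) * (A * seq A) =>
         (f (q.1.1, (q.1.2.1, q.2.1)), q.2.2)).
    by computability; apply: (computable_app fc); computability.
  by apply: (computable_seq_case _ _ g_comp); computability.
have := computable_fst (computable_iter (computable_pickle sc) step_comp
  (computable_pair zc sc)).
congr computable; apply/funext => x /=.
have size_pickle : size (s x) <= pickle (s x).
  elim: (s x) => // a t IHt; rewrite pickle_cons.
  by rewrite (leq_ltn_trans IHt) // /code_cons -addnn; nia.
move: (pickle (s x)) size_pickle => k; move: (s x) (z x).
elim: k => [|k IHk] [|a t] b // kle; rewrite iterSr; last exact: IHk.
exact: (IHk [::]).
Qed.

Lemma computable_behead X A (s : X -> seq A) :
  computable s -> computable (fun x => behead (s x)).
Proof.
move=> sc; apply: (computable_seq_case (g := fun p => p.2.2) sc).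
  exact: computable_const.
by computability.
Qed.

Lemma computable_head X A (d : A) (s : X -> seq A) :
  computable s -> computable (fun x => head d (s x)).
Proof.
move=> sc; apply: (computable_seq_case (g := fun p => p.2.1) sc).
  exact: computable_const.
by computability.
Qed.

Lemma computable_drop X A (n : X -> nat) (s : X -> seq A) :
  computable n -> computable s -> computable (fun x => drop (n x) (s x)).
Proof.
move=> nc sc.
have beheadc : computable (fun p : X * seq A => behead p.2).
  by apply: computable_behead; computability.
have := computable_iter nc beheadc sc; congr computable; apply/funext => x /=.
elim: (n x) (s x) => [|k IHk] t; first by rewrite drop0.
by rewrite iterSr IHk; case: t.
Qed.

Lemma computable_nth X A (d : A) (s : X -> seq A) (n : X -> nat) :
  computable s -> computable n -> computable (fun x => nth d (s x) (n x)).
Proof.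
move=> sc nc; have := computable_head d (computable_drop nc sc).
by congr computable; apply/funext => x; rewrite -nth0 nth_drop addn0.
Qed.

Lemma computable_rev X A (s : X -> seq A) :
  computable s -> computable (fun x => rev (s x)).
Proof.
move=> sc; have consc : computable (fun p : X * (seq A * A) => p.2.2 :: p.2.1).
  by computability.
have := computable_foldl consc (computable_const X [::]) sc.
congr computable; apply/funext => x; rewrite -{1}[s x]revK foldl_rev.
by elim: (rev _) => //= a t ->.
Qed.

Lemma computable_cat X A (s t : X -> seq A) :
  computable s -> computable t -> computable (fun x => s x ++ t x).
Proof.
move=> sc tc.
have consc : computable (fun p : X * (seq A * A) => p.2.2 :: p.2.1).
  by computability.
have := computable_foldl consc tc (computable_rev sc).
congr computable; apply/funext => x; rewrite foldl_rev.
by elim: (s x) => //= a u ->.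
Qed.

Lemma computable_map X A B (f : X * A -> B) (s : X -> seq A) :
  computable f -> computable s ->
  computable (fun x => [seq f (x, a) | a <- s x]).
Proof.
move=> fc sc; have consc : computable
    (fun p : X * (seq B * A) => f (p.1, p.2.2) :: p.2.1).
  by computability; apply: (computable_app fc); computability.
have := computable_foldl consc (computable_const X [::]) (computable_rev sc).
by congr computable; apply/funext => x; rewrite foldl_rev.
Qed.

Lemma computable_size X A (s : X -> seq A) :
  computable s -> computable (fun x => size (s x)).
Proof.
move=> sc; have succc : computable (fun p : X * (nat * A) => p.2.1.+1).
  by apply: computable_succ; computability.
have := computable_foldl succc (computable_const X 0) (computable_rev sc).
by congr computable; apply/funext => x; rewrite foldl_rev.
Qed.

(** The prefix of length [n] is obtained by dropping, from the reversed list, as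
    many entries as remain after the prefix. *)
Lemma computable_take X A (n : X -> nat) (s : X -> seq A) :
  computable n -> computable s -> computable (fun x => take (n x) (s x)).
Proof.
move=> nc sc; have := computable_rev (computable_drop
  (computable_size (computable_drop nc sc)) (computable_rev sc)).
congr computable; apply/funext => x; rewrite size_drop drop_rev revK.
case: (leqP (n x) (size (s x))) => [/subKn -> //|/ltnW le].
by rewrite !take_oversize // (eqP le) subn0.
Qed.

Lemma computable_addn X (m n : X -> nat) :
  computable m -> computable n -> computable (fun x => m x + n x).
Proof.
move=> mc nc; have succc : computable (fun p : X * nat => p.2.+1).
  by apply: computable_succ; computability.
have := computable_iter nc succc mc; congr computable; apply/funext => x.
exact: iter_succn.
Qed.

Lemma computable_muln X (m n : X -> nat) :
  computable m -> computable n -> computable (fun x => m x * n x).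
Proof.
move=> mc nc; have addc : computable (fun p : X * nat => n p.1 + p.2).
  by apply: computable_addn; [apply: (computable_app nc)|]; computability.
have := computable_iter mc addc (computable_const X 0).
congr computable; apply/funext => x.
by elim: (m x) => // k IHk; rewrite iterS IHk.
Qed.

Lemma computable_expn X (m n : X -> nat) :
  computable m -> computable n -> computable (fun x => m x ^ n x).
Proof.
move=> mc nc; have mulc : computable (fun p : X * nat => m p.1 * p.2).
  by apply: computable_muln; [apply: (computable_app mc)|]; computability.
have := computable_iter nc mulc (computable_const X 1).
congr computable; apply/funext => x.
by elim: (n x) => // k IHk; rewrite iterS IHk expnS.
Qed.

(** Operations on lists and numbers are also followed syntactically; a
    subexpression that needs a lemma of its own is taken from the context. *)
Ltac list_computability := repeat first [ progress computability | assumption |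
  lazymatch goal with
  | |- @computable _ _ ?F => lazymatch F with
    | fun x => head _ (@?s x) => apply: (@computable_head _ _ _ s)
    | fun x => behead (@?s x) => apply: (@computable_behead _ _ s)
    | fun x => size (@?s x) => apply: (@computable_size _ _ s)
    | fun x => take (@?n x) (@?s x) => apply: (@computable_take _ _ n s)
    | fun x => drop (@?n x) (@?s x) => apply: (@computable_drop _ _ n s)
    | fun x => nth _ (@?s x) (@?n x) => apply: (@computable_nth _ _ _ s n)
    | fun x => @?s x ++ @?t x => apply: (@computable_cat _ _ s t)
    | fun x => (@?m x + @?n x)%N => apply: (@computable_addn _ m n)
    | fun x => (@?m x * @?n x)%N => apply: (@computable_muln _ m n)
    | fun x => (@?m x ^ @?n x)%N => apply: (@computable_expn _ m n)
    | fun x => (@?n x).+1 => apply: (@computable_succ _ n)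
    end
  end ].

(** The least number satisfying [p], or [n] if it is not below [n]: the
    candidate stops moving as soon as it satisfies [p]. *)
Definition search (p : nat -> bool) (n : nat) : nat :=
  iter n (fun k => if p k then k else k.+1) 0.

Lemma computable_search X (p : X * nat -> bool) (n : X -> nat) :
  computable p -> computable n ->
  computable (fun x => search (fun k => p (x, k)) (n x)).
Proof.
move=> pc nc.
have stepc : computable (fun q : X * nat => if p q then q.2 else q.2.+1).
  by apply: computable_if => //; [|apply: computable_succ]; computability.
exact: computable_iter nc stepc (computable_const X 0).
Qed.

Lemma searchP (p : nat -> bool) n k : p k -> k < n -> p (search p n).
Proof.
move=> pk kn.
suff /orP[//|/eqP srch] : p (search p n) || (search p n == n).
  exfalso; move: srch; suff : search p n <= k by lia.
  elim: n {kn} => // n IHn; rewrite /search iterS -/(search p n).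
  case: ifP => // /negbT pn; rewrite ltn_neqAle IHn andbT.
  by apply: contra pn => /eqP ->.
elim: {kn} n => [|n IHn]; first by rewrite orbT.
rewrite /search iterS -/(search p n); case: ifP => [->//|pn].
by move: IHn; rewrite pn /= => /eqP ->; rewrite eqxx orbT.
Qed.

(** Passage back to the relational form of the partial recursive functions. *)
Lemma computable_partial_recursive (A B C : countType) (f : A * B -> C) :
  computable f ->
  exists2 F : 2.-tuple nat -> nat -> Prop, partial_recursive F &
    forall a b, F [tuple pickle a; pickle b] (pickle (f (a, b))).
Proof.
move=> [g grec gE].
have grec2 := total_recursive_app grec
  (total_recursive_app2 recursive2_code_cons (total_recursive_proj ord0)
    (total_recursive_app2 recursive2_code_cons (total_recursive_proj ord_max)
      (total_recursive0 2))).
exists (fun x y => y = g (code_pair (tnth x ord0) (tnth x ord_max))) => // a b.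
by rewrite !(tnth_nth 0) /= -pickle_pair gE.
Qed.

(** * The Hurwitz action on sequences *)

Section HurwitzWords.
Variable G : groupType.
Local Open Scope group_scope.
Implicit Types (g h p q : seq G) (w : seq (signed nat)).

(** The action of one crossing, on plain sequences and with generators numbered
    by [nat], so that concatenation and shifts need no change of type.  A
    crossing outside the sequence does nothing. *)
Fixpoint hurwitz_at (i : nat) (e : bool) g : seq G :=
  match i, g with
  | 0, a :: b :: q =>
      if e then a * b * a^-1 :: a :: q else b :: b^-1 * a * b :: q
  | i'.+1, a :: q => a :: hurwitz_at i' e q
  | _, _ => g
  end.

Definition hurwitz_seq g w := foldl (fun h x => hurwitz_at x.1 x.2 h) g w.

Definition braid_on (m : nat) w := all (fun x => x.1.+1 < m) w.

Definition shift_braid (k : nat) w := [seq (k + x.1, x.2)%N | x <- w].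

Lemma size_hurwitz_at i e g : size (hurwitz_at i e g) = size g.
Proof.
elim: i g => [|i IHi] [|a g] //=; last by rewrite IHi.
by case: g => [|b g] //; case: e.
Qed.

Lemma hurwitz_atK i e g : hurwitz_at i (~~ e) (hurwitz_at i e g) = g.
Proof.
elim: i g => [|i IHi] [|a g] //=; last by rewrite IHi.
case: g => [|b g] //=.
by case: e => /=; rewrite !mulgA ?mulVg ?mulgV mul1g ?mulgK ?mulgVK.
Qed.

Lemma hurwitz_at_cat i e p q :
  i.+1 < size p -> hurwitz_at i e (p ++ q) = hurwitz_at i e p ++ q.
Proof.
elim: i p => [|i IHi] [|a p] //=; first by case: p => //= b p; case: e.
by rewrite ltnS => /IHi ->.
Qed.

Lemma hurwitz_at_shift i e p q :
  hurwitz_at (size p + i) e (p ++ q) = p ++ hurwitz_at i e q.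
Proof. by elim: p => //= a p ->. Qed.

(** Conjugating [a] by [b] is what makes [a * b = b * (b^-1 * a * b)]. *)
Lemma prod_hurwitz_at i e g :
  \prod_(a <- hurwitz_at i e g) a = \prod_(a <- g) a.
Proof.
elim: i g => [|i IHi] [|a g] //=; last by rewrite !big_cons IHi.
case: g => [|b g] //; case: e; rewrite !big_cons !mulgA ?mulgVK //.
by rewrite mulgV mul1g.
Qed.

Lemma nth_hurwitz_at i e g k : i.+1 < size g -> nth 1 (hurwitz_at i e g) k =
  if k == i then if e then nth 1 g i * nth 1 g i.+1 * (nth 1 g i)^-1
                 else nth 1 g i.+1
  else if k == i.+1 then if e then nth 1 g i
                 else (nth 1 g i.+1)^-1 * nth 1 g i * nth 1 g i.+1
  else nth 1 g k.
Proof.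
elim: i g k => [|i IHi] [|a g] k //=.
  by case: g k => [//|b g] [|[|k]]; case: e.
by case: k => [//|k]; rewrite ltnS => /IHi /= ->.
Qed.

Lemma hurwitz_letter_at m (g : m.-tuple G) (x : signed 'I_m.-1) :
  tval (hurwitz_letter g x) = hurwitz_at x.1 x.2 g.
Proof.
case: x => i e; have im : i.+1 < m by have := ltn_ord i; lia.
apply: (@eq_from_nth _ 1); first by rewrite size_hurwitz_at !size_tuple.
move=> k _; rewrite nth_hurwitz_at ?size_tuple //.
by case: e; rewrite /hurwitz_letter /= ?nth_sigma ?nth_sigmaV.
Qed.

Lemma hurwitz_seq_cat g w w' :
  hurwitz_seq g (w ++ w') = hurwitz_seq (hurwitz_seq g w) w'.
Proof. exact: foldl_cat. Qed.

Lemma size_hurwitz_seq g w : size (hurwitz_seq g w) = size g.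
Proof. by elim: w g => //= x w IHw g; rewrite IHw size_hurwitz_at. Qed.

Lemma prod_hurwitz_seq g w :
  \prod_(a <- hurwitz_seq g w) a = \prod_(a <- g) a.
Proof. by elim: w g => //= x w IHw g; rewrite IHw prod_hurwitz_at. Qed.

Lemma hurwitz_seq_inv g w : hurwitz_seq (hurwitz_seq g w) (inv_word w) = g.
Proof.
elim: w g => //= x w IHw g; rewrite -cat1s inv_word_cat hurwitz_seq_cat.
by rewrite IHw; exact: hurwitz_atK.
Qed.

(** Locality of the action: this is what lets a relation be applied inside a
    longer word. *)
Lemma hurwitz_seq_block p g q w : braid_on (size g) w ->
  hurwitz_seq (p ++ g ++ q) (shift_braid (size p) w) =
  p ++ hurwitz_seq g w ++ q.
Proof.
elim: w g => //= x w IHw g /andP[xg wg].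
rewrite hurwitz_at_shift hurwitz_at_cat // IHw //.
by rewrite size_hurwitz_at.
Qed.

Lemma braid_on_inv m w : braid_on m (inv_word w) = braid_on m w.
Proof. by rewrite /braid_on /inv_word all_rev all_map. Qed.

Lemma braid_on_cat m w w' :
  braid_on m (w ++ w') = braid_on m w && braid_on m w'.
Proof. exact: all_cat. Qed.

Lemma braid_on_shift k l m w : k + l <= m -> braid_on l w ->
  braid_on m (shift_braid k w).
Proof.
move=> klm /allP wl; rewrite /braid_on all_map; apply/allP => x /wl /=.
lia.
Qed.

Definition nat_braid m (w : braid_word m) : seq (signed nat) :=
  [seq (nat_of_ord x.1, x.2) | x <- w].

Lemma braid_on_nat_braid m (w : braid_word m) : braid_on m (nat_braid w).
Proof.
rewrite /braid_on all_map; apply/allP => -[i e] _ /=; have := ltn_ord i; lia.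
Qed.

Lemma nat_braid_onto m w : braid_on m w ->
  exists w' : braid_word m, nat_braid w' = w.
Proof.
elim: w => [|[i e] w IHw] /=; first by exists [::].
move=> /andP[im /IHw [w' <-]]; have im' : i < m.-1 by lia.
by exists ((Ordinal im', e) :: w').
Qed.

(** An ordinal is coded by its value, so forgetting the number of strands does
    not change the code of a braid word. *)
Lemma pickle_nat_braid m (w : braid_word m) : pickle (nat_braid w) = pickle w.
Proof. by congr CodeSeq.code; rewrite /nat_braid -map_comp. Qed.

Lemma hurwitz_act_seq m (g : m.-tuple G) (w : braid_word m) :
  tval (hurwitz_act g (braid_of w)) = hurwitz_seq g (nat_braid w).
Proof.
rewrite hurwitz_act_class; elim: w g => //= x w IHw g.
by rewrite IHw hurwitz_letter_at.
Qed.

Lemma hurwitz_equivP m (g g' : m.-tuple G) :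
  hurwitz_equiv g g' <->
  exists2 w, braid_on m w & hurwitz_seq g w = g'.
Proof.
split=> [[b <-]|[w /nat_braid_onto [w' <-] gg']].
  rewrite -(word_classK b); exists (nat_braid (repr b)).
    exact: braid_on_nat_braid.
  by rewrite -hurwitz_act_seq.
by exists (braid_of w'); apply: val_inj; rewrite /= hurwitz_act_seq.
Qed.

End HurwitzWords.

(** * Searching for a chain of rewritings *)

Definition code_bound (k n : nat) := 2 ^ (k.+1 * n).

(** Each entry [x] contributes a factor [2 ^ x.+1] at most:
    [2 ^ x * (2 * c + 1) < 2 ^ x.+1 * (c + 1)]. *)
Lemma ltn_code_bound k n s : all (fun x => x <= k) s -> size s <= n ->
  CodeSeq.code s < code_bound k n.
Proof.
elim: s n => [|x s IHs] n /=; first by rewrite expn_gt0.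
case: n => [//|n] /andP[xk sk] /(IHs _ sk) lt.
rewrite /code_bound (mulnS k.+1) expnD.
apply: (@leq_trans (2 ^ x.+1 * 2 ^ (k.+1 * n))).
  apply: (@leq_trans (2 ^ x.+1 * (CodeSeq.code s).+1)); last first.
    by rewrite leq_mul2l lt orbT.
  rewrite expnSr -mulnA ltn_pmul2l ?expn_gt0 //.
  by rewrite mul2n doubleS.
by rewrite leq_mul2r leq_exp2l // ltnS xk orbT.
Qed.

(** All lists of lists of numbers, without repetition: this enumerates the
    instructions for the solver. *)
Definition certificate (k : nat) : seq (seq nat) :=
  map CodeSeq.decode (CodeSeq.decode k).

Lemma pickle_seq_nat (s : seq nat) : pickle s = CodeSeq.code s.
Proof. by congr CodeSeq.code; exact: map_id. Qed.

Lemma pickle_certificate k : pickle (certificate k) = k.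
Proof.
rewrite -[RHS]CodeSeq.decodeK; congr CodeSeq.code; rewrite -map_comp.
rewrite -[RHS]map_id; apply: eq_map => n /=.
by rewrite pickle_seq_nat CodeSeq.decodeK.
Qed.

Lemma certificateK c : certificate (pickle c) = c.
Proof. exact: (pcan_inj pickleK (pickle_certificate _)). Qed.

Section Solver.
Variables (S : finType) (G : groupType) (iota : S -> G).

(** A rule replaces the first word by the second; its braid is meant to carry
    the system of the former to that of the latter. *)
Definition rule : Type := ((seq S * seq S) * seq (signed nat))%type.
(** The current word, and the braid collected since the start. *)
Definition state : Type := (seq S * seq (signed nat))%type.

Definition carries (a : seq S) (x : state) : Prop :=
  braid_on (size a) x.2 /\ hurwitz_seq (map iota a) x.2 = map iota x.1.

Definition sound_rule (r : rule) : Prop := carries r.1.1 (r.1.2, r.2).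

Definition trivial_rule : rule := ([::], [::], [::]).

Definition rewrite_at (r : rule) (i : nat) (x : state) : state :=
  let p := take i x.1 in
  let q := drop (i + size r.1.1) x.1 in
  if p ++ r.1.1 ++ q == x.1
  then (p ++ r.1.2 ++ q, x.2 ++ shift_braid (size p) r.2) else x.

(** An instruction lists a position and the index of a rule; ill-formed
    instructions are harmless, since [rewrite_at] changes nothing unless the
    word matches and an index that is too large selects the trivial rule. *)
Definition follow (T : seq rule) (x : state) (c : seq nat) : state :=
  rewrite_at (nth trivial_rule T (head 0 (behead c))) (head 0 c) x.

Definition run (T : seq rule) (a : seq S) (c : seq (seq nat)) : state :=
  foldl (follow T) (a, [::]) c.

(** An instruction has two entries, at most [size a] and [size T]; a chain
    without repetition visits each word of the length of [a] at most once. *)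
Definition search_bound (T : seq rule) (a : seq S) : nat :=
  code_bound (code_bound (size a + size T) 2) (#|S| ^ size a).

Definition find_braid (T : seq rule) (a a' : seq S) :
    option (seq (signed nat)) :=
  let k := search (fun k => (run T a (certificate k)).1 == a')
    (search_bound T a) in
  let x := run T a (certificate k) in
  if x.1 == a' then Some x.2 else None.

Lemma size_carries a x : carries a x -> size x.1 = size a.
Proof.
by move=> [_ /(congr1 size)]; rewrite size_hurwitz_seq !size_map.
Qed.

(** The shift is the length of the prefix actually found, which differs from [i]
    when [i] exceeds the length of the word. *)
Lemma carries_rewrite a x r i :
  sound_rule r -> carries a x -> carries a (rewrite_at r i x).
Proof.
move=> [rb re] ax; have sx := size_carries ax; case: ax => xb xe.
rewrite /rewrite_at; case: eqP => // xE; split.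
  rewrite braid_on_cat xb; apply: braid_on_shift rb.
  by rewrite -sx -[in leqRHS]xE !size_cat addnA leq_addr.
rewrite hurwitz_seq_cat xe -{1}xE.
move: (take _ _) (drop _ _) => p q; rewrite !map_cat -{1}(size_map iota p).
by rewrite hurwitz_seq_block ?size_map // re.
Qed.

Lemma carries_run T a c : (forall r, r \in T -> sound_rule r) ->
  carries a (run T a c).
Proof.
move=> Tsound; rewrite /run; have : carries a (a, [::]) by [].
elim: c (a, _) => //= c cs IHc x ax; apply: IHc; apply: carries_rewrite ax.
case: (ltnP (head 0 (behead c)) (size T)) => lt.
  exact/Tsound/mem_nth.
by rewrite nth_default.
Qed.

Lemma find_braid_sound T a a' w : (forall r, r \in T -> sound_rule r) ->
  find_braid T a a' = Some w ->
  braid_on (size a) w /\ hurwitz_seq (map iota a) w = map iota a'.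
Proof.
move=> Tsound; rewrite /find_braid; set c := certificate _.
by case: eqP => // <- [<-]; exact: carries_run.
Qed.

Variable R : seq (seq S * seq S).

Definition word_step (x y : seq S) : Prop :=
  exists p q u v, [/\ relator R u v \/ relator R v u,
    x = p ++ u ++ q & y = p ++ v ++ q].

(** Rewriting one factor at a time suffices because chains of such rewritings
    are reversible and can be carried out inside any context. *)
Lemma equivp_steps x y : equivp R x y -> clos_refl_trans _ word_step x y.
Proof.
have cat_steps p q u v : clos_refl_trans _ word_step u v ->
    clos_refl_trans _ word_step (p ++ u ++ q) (p ++ v ++ q).
  elim=> {u v} [u v [p' [q' [u' [v' [uv -> ->]]]]]|u|u v w _ IHu _ IHv].
  - apply: rt_step; exists (p ++ p'), (q' ++ q), u', v'.
    by rewrite -!catA.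
  - exact: rt_refl.
  - exact: rt_trans IHu IHv.
elim=> {x y} [u v uv|u|u v _ IH|v u w _ IHu _ IHv|u u' v v' _ IHu _ IHv].
- apply: rt_step; exists [::], [::], u, v; rewrite !cats0; by split=> //; left.
- exact: rt_refl.
- elim: IH => {u v} [u v [p [q [u' [v' [uv -> ->]]]]]|u|u v w _ IHu _ IHv].
  + by apply: rt_step; exists p, q, v', u'; split=> //; case: uv; [right|left].
  + exact: rt_refl.
  + exact: rt_trans IHv IHu.
- exact: rt_trans IHu IHv.
- have := cat_steps u' [::] _ _ IHv; rewrite !cats0.
  by apply: rt_trans; exact: cat_steps [::] v _ _ IHu.
Qed.

Definition tuple_step (m : nat) : rel (m.-tuple S) :=
  fun a b => `[< word_step a b >].

(** By homogeneity the chain stays among the words of a fixed length, a finite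
    graph, where connectedness is witnessed by paths without repetition. *)
Lemma steps_connect (homP : homogeneous R) x y :
  clos_refl_trans _ word_step x y ->
  size x = size y /\
  forall m (a b : m.-tuple S), x = a -> y = b -> connect (@tuple_step m) a b.
Proof.
elim=> {x y} [x y xy|x|x y z _ [sxy IHx] _ [syz IHy]]; split=> //.
- case: xy => p [q [u [v [uv -> ->]]]]; rewrite !size_cat.
  by congr (_ + (_ + _)); case: uv => /homP.
- by move=> m a b xa yb; apply/connect1/asboolP; rewrite -xa -yb.
- by move=> m a b -> /val_inj ->; exact: connect0.
- by rewrite sxy.
- move=> m a b xa zb; have ym : size y == m by rewrite -sxy xa size_tuple.
  apply: (@connect_trans _ _ (Tuple ym)); first exact: IHx.
  exact: IHy.
Qed.

Variable T : seq rule.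
Hypothesis T_complete : forall u v, relator R u v \/ relator R v u ->
  exists w, (u, v, w) \in T.

Lemma follow_step x y w : word_step x y -> exists i k w',
  [/\ i <= size x, k < size T & follow T (x, w) [:: i; k] = (y, w')].
Proof.
move=> [p [q [u [v [/T_complete [w' uvT] -> ->]]]]].
exists (size p), (index (u, v, w') T).
exists (w ++ shift_braid (size p) w'); split.
- by rewrite size_cat leq_addr.
- by rewrite index_mem.
- rewrite /follow /= nth_index // /rewrite_at /=.
  by rewrite take_size_cat // [in drop _ _]catA -size_cat drop_size_cat // eqxx.
Qed.

Lemma follow_path m (a : m.-tuple S) p w : path (@tuple_step m) a p ->
  exists c : seq (seq nat), [/\ size c = size p,
    all (fun s => CodeSeq.code s <= code_bound (m + size T) 2) c &
    (foldl (follow T) (tval a, w) c).1 = last a p].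
Proof.
elim: p a w => [|b p IHp] a w /=; first by exists [::].
move=> /andP[/asboolP /follow_step - /(_ w) [i [k [w' [im kT step]]]] /IHp].
move=> /(_ w') [c [sc cb cp]]; exists ([:: i; k] :: c); split=> /=.
- by rewrite sc.
- rewrite cb andbT; apply: ltnW.
  apply: (@ltn_code_bound _ _ [:: i; k]) => //=.
  rewrite size_tuple in im; lia.
- by rewrite step.
Qed.

(** A path without repetition gives a list of instructions whose code is below
    the bound. *)
Lemma find_braid_complete (homP : homogeneous R) m (a a' : m.-tuple S) :
  equivp R a a' -> find_braid T a a' <> None.
Proof.
move=> /equivp_steps /(steps_connect homP) [_ /(_ _ _ _ erefl erefl)].
case/connectP=> p0 /shortenP [p ap up _] a'E.
have [c [sc cb cp]] := follow_path [::] ap.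
suff : (run T a (certificate (search
    (fun k => (run T a (certificate k)).1 == a') (search_bound T a)))).1 == a'.
  by rewrite /find_braid => ->.
apply: (@searchP (fun k => (run T a (certificate k)).1 == a') _ (pickle c)).
  by rewrite certificateK /run cp a'E.
apply: ltn_code_bound.
  rewrite all_map size_tuple; apply: sub_all cb => s /=.
  by rewrite pickle_seq_nat.
rewrite size_map sc size_tuple -card_tuple ltnW //.
by move/card_uniqP: up => /= <-; exact: max_card.
Qed.

End Solver.

Section ComputableSolver.
Variables (S : finType) (T : seq (rule S)).

Lemma computable_follow :
  computable (fun q : state S * seq nat => follow T q.1 q.2).
Proof.
have r_comp : computable (fun q : state S * seq nat =>
    nth (trivial_rule S) T (head 0 (behead q.2))) by list_computability.
have shift_comp : computable (fun q : (nat * seq (signed nat)) =>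
    shift_braid q.1 q.2).
  have := @computable_map _ _ _
    (fun p : (nat * seq (signed nat)) * signed nat => (p.1.1 + p.2.1, p.2.2))
    (fun q => q.2).
  by apply; list_computability.
have lhs_comp := computable_fst (computable_fst r_comp).
have rhs_comp := computable_snd (computable_fst r_comp).
have braid_comp := computable_snd r_comp.
rewrite /follow /rewrite_at; apply: computable_if; list_computability.
by apply: (computable_app2 shift_comp); list_computability.
Qed.

Lemma computable_run :
  computable (fun p : seq S * seq (seq nat) => run T p.1 p.2).
Proof.
have step_comp : computable (fun q : (seq S * seq (seq nat)) *
    (state S * seq nat) => follow T q.2.1 q.2.2).
  by apply: (computable_app2 computable_follow); computability.
by apply: (computable_foldl step_comp); computability.
Qed.

(** A list of instructions is represented by its own code, so the identity
    computes [certificate]. *)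
Lemma computable_certificate : computable certificate.
Proof.
by exists id; [exact: recursive_id|move=> k; rewrite pickle_certificate].
Qed.

Lemma computable_find_braid :
  computable (fun p : seq S * seq S => find_braid T p.1 p.2).
Proof.
have bound_comp : computable (fun p : seq S * seq S => search_bound T p.1).
  by rewrite /search_bound /code_bound; list_computability.
have run_comp : computable (fun q : (seq S * seq S) * nat =>
    run T q.1.1 (certificate q.2)).
  apply: (computable_app2 computable_run); computability.
  by apply: (computable_app computable_certificate); computability.
have test_comp : computable (fun q : (seq S * seq S) * nat =>
    (run T q.1.1 (certificate q.2)).1 == q.1.2).
  by computability.
have found_comp := computable_app run_comp
  (computable_pair (computable_id _) (computable_search test_comp bound_comp)).
apply: computable_if; first by computability.
  by apply: computable_Some; computability.
exact: computable_const.
Qed.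

End ComputableSolver.

(** * Word reversing in the monoid *)

Section Reversing.
Variables (S : finType) (R : seq (seq S * seq S)).

(** [w] describes a walk from [x] to [y] in the Cayley graph of the monoid. *)
Fixpoint joined (w : seq (signed S)) (x y : seq S) : Prop :=
  match w with
  | [::] => equivp R x y
  | (s, false) :: w' => joined w' (rcons x s) y
  | (s, true) :: w' => exists2 z, equivp R x (rcons z s) & joined w' z y
  end.

Lemma equivp_catl z x y : equivp R x y -> equivp R (z ++ x) (z ++ y).
Proof. exact: congr_cat (congr_refl _ _). Qed.

Lemma equivp_catr z x y : equivp R x y -> equivp R (x ++ z) (y ++ z).
Proof. by move=> xy; exact: congr_cat xy (congr_refl _ _). Qed.

Lemma joined_equivp w x x' y : equivp R x x' -> joined w x y -> joined w x' y.
Proof.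
elim: w x x' => [|[s []] w IHw] x x' /= /congr_sym xx'.
- exact: congr_trans.
- by case=> z xz zy; exists z => //; exact: congr_trans xz.
- by apply: IHw; rewrite -!cats1; apply/equivp_catr/congr_sym.
Qed.

Lemma joined_cat w w' x y :
  joined (w ++ w') x y <-> exists2 z, joined w x z & joined w' z y.
Proof.
elim: w x => [|[s []] w IHw] x /=.
- split=> [xy|[z /congr_sym]]; last exact: joined_equivp.
  by exists x => //; exact: congr_refl.
- split=> [[t xt /IHw [z tz zy]]|[z [t xt tz] zy]].
    by exists z => //; exists t.
  by exists t => //; apply/IHw; exists z.
- exact: IHw.
Qed.

Lemma joined_pos u x y : joined (pos_word u) x y <-> equivp R (x ++ u) y.
Proof.
by elim: u x => [|s u IHu] x; rewrite ?cats0 //= IHu cat_rcons.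
Qed.

Lemma joined_inv u x y :
  joined (inv_word (pos_word u)) x y <-> equivp R x (y ++ u).
Proof.
elim: u x y => [|s u IHu] x y; first by rewrite cats0.
rewrite /= -cat1s inv_word_cat joined_cat -cat_rcons.
split=> [[z /IHu xz /= [t zt ty]]|xy].
  apply: congr_trans xz _; apply: equivp_catr; apply: congr_trans zt _.
  by rewrite -!cats1; exact: equivp_catr.
exists (rcons y s); first exact/IHu.
by exists y; exact: congr_refl.
Qed.

(** A walk along [u^-1 v] is [t u -> t -> t v]; if [u u'] and [v v'] are
    equivalent it can be replaced by [t u -> t u u' = t v v' -> t v].  No
    cancellation is used. *)
Lemma joined_step w w' x y : rev_step R w w' -> joined w x y -> joined w' x y.
Proof.
case=> [l r u v u' v' _ _ uv|l r u _] /joined_cat[z1 xz1] /joined_cat[z2];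
  case/joined_cat=> t /joined_inv z1t /joined_pos tz2 z2y.
- apply/joined_cat; exists z1 => //; apply/joined_cat; exists z2 => //.
  apply/joined_cat; exists (z1 ++ u'); first exact/joined_pos/congr_refl.
  apply/joined_inv; apply: congr_trans (equivp_catr u' z1t) _.
  apply: (congr_trans (v := t ++ v ++ v')); last first.
    by rewrite catA; exact: equivp_catr.
  rewrite -catA; apply: equivp_catl.
  by case: uv => uv; [|apply: congr_sym]; exact: congr_rel.
- apply/joined_cat; exists z1 => //.
  by apply: joined_equivp z2y; apply/congr_sym; exact: congr_trans z1t tz2.
Qed.

Lemma reverses_equivp u v : reverses R (quot_word u v) [::] -> equivp R u v.
Proof.
move=> rev; have : joined (quot_word u v) u v.
  apply/joined_cat; exists [::]; first exact/joined_inv/congr_refl.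
  exact/joined_pos/congr_refl.
rewrite -/(joined [::] u v).
elim: rev => [w w' /joined_step|//|w1 w2 w3 _ IH1 _ IH2 /IH1 /IH2 //].
exact.
Qed.

End Reversing.

(** * Rules from compatible relations *)

Section SoundRules.
Variables (S : finType) (G : groupType) (iota : S -> G).

Lemma compatible_rule (r : seq S * seq S) : hurwitz_compatible iota r ->
  exists w, sound_rule iota (r, w).
Proof.
case=> l [a [a' [-> /hurwitz_equivP [w wl aw]]]]; exists w.
by split; rewrite //= size_tuple.
Qed.

Lemma sound_rule_inv u v w : sound_rule iota (u, v, w) ->
  sound_rule iota (v, u, inv_word w).
Proof.
move=> uvw; have /= sz := size_carries uvw; case: uvw => /= wb we.
by split; rewrite /= ?braid_on_inv ?sz // -we hurwitz_seq_inv.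
Qed.

(** The inverse braid serves the relation read backwards, so that the rules can
    perform every rewriting in the congruence. *)
Lemma sound_rules (R : seq (seq S * seq S)) :
  (forall r, r \in R -> hurwitz_compatible iota r) ->
  exists2 T : seq (rule S), (forall r, r \in T -> sound_rule iota r) &
    forall u v, relator R u v \/ relator R v u -> exists w, (u, v, w) \in T.
Proof.
rewrite /relator; elim: R => [_|[u v] R IHR hur].
  by exists [::] => // u v [].
have [|T Tsound Tall] := IHR.
  by move=> r rR; apply: hur; rewrite inE rR orbT.
have [w uvw] := compatible_rule (hur _ (mem_head _ _)).
exists [:: (u, v, w), (v, u, inv_word w) & T].
  move=> r; rewrite !inE => /or3P[/eqP ->|/eqP ->|] //.
    exact: sound_rule_inv.
  exact: Tsound.
move=> u' v' uv'.
case: (pselect ((u', v') \in R \/ (v', u') \in R)) => [/Tall|].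
  by case=> w' w'T; exists w'; rewrite !inE w'T !orbT.
case: uv' => /[!inE] /orP[/eqP[-> ->] _|uv' []]; [| by left | | by right].
- by exists w; rewrite !inE eqxx.
- by exists (inv_word w); rewrite !inE eqxx orbT.
Qed.

End SoundRules.

(** * Coxeter elements and the solution of the Hurwitz problems *)

Lemma hurwitz_equiv_coxeter (S : finType) (G : groupType) (iota : S -> G) m
    (a a' : m.-tuple S) :
  hurwitz_equiv (gsys iota a) (gsys iota a') ->
  coxeter_element iota a = coxeter_element iota a'.
Proof.
have prodE (b : m.-tuple S) :
    coxeter_element iota b = (\prod_(g <- gsys iota b) g)%g.
  by rewrite big_map big_tuple.
by rewrite !prodE => /hurwitz_equivP [w _ <-]; rewrite prod_hurwitz_seq.
Qed.

Lemma coxeter_equivp (S : finType) (R : seq (seq S * seq S)) (G : groupType)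
    (iota : S -> G) m (a a' : m.-tuple S) : presents R iota ->
  injective (@nat_map S R G iota) ->
  coxeter_element iota a = coxeter_element iota a' ->
  equivp R (coxeter_word a) (coxeter_word a').
Proof.
move=> pres inj; rewrite /coxeter_element -!(big_tuple _ _ _ predT iota).
by rewrite -!(nat_map_class _ pres) => /inj /word_classP.
Qed.

Theorem theorem2 (S : finType) (R : seq (seq S * seq S)) (G : groupType)
    (iota : S -> G) (presP : presents R iota) (homP : homogeneous R)
    (hurP : forall r : seq S * seq S, r \in R -> hurwitz_compatible iota r) :
  [/\ (forall (m : nat) (a a' : m.-tuple S),
         equivp R (coxeter_word a) (coxeter_word a') ->
         hurwitz_equiv (gsys iota a) (gsys iota a')),
      (forall (m : nat) (a a' : m.-tuple S),
         reverses R (quot_word (coxeter_word a) (coxeter_word a')) [::] ->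
         hurwitz_equiv (gsys iota a) (gsys iota a')) /\
      (exists2 F : 2.-tuple nat -> nat -> Prop, partial_recursive F &
         forall (m : nat) (a a' : m.-tuple S),
           reverses R (quot_word (coxeter_word a) (coxeter_word a')) [::] ->
           exists2 w : braid_word m, F (pair_code a a') (pickle w) &
             hurwitz_act (gsys iota a) (braid_of w) = gsys iota a'),
      (injective (@nat_map S R G iota) ->
       forall (m : nat) (a a' : m.-tuple S),
         hurwitz_equiv (gsys iota a) (gsys iota a') <->
         coxeter_element iota a = coxeter_element iota a')
    & (injective (@nat_map S R G iota) -> complete R ->
       (forall (m : nat) (a a' : m.-tuple S),
          hurwitz_equiv (gsys iota a) (gsys iota a') <->
          reverses R (quot_word (coxeter_word a) (coxeter_word a')) [::]) /\
       (exists2 F : 2.-tuple nat -> nat -> Prop, partial_recursive F &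
          forall (m : nat) (a a' : m.-tuple S),
            exists2 o : option (braid_word m), F (pair_code a a') (pickle o) &
              match o with
              | Some w => hurwitz_act (gsys iota a) (braid_of w) = gsys iota a'
              | None => ~ hurwitz_equiv (gsys iota a) (gsys iota a')
              end))].
Proof.
have [T Tsound Tall] := sound_rules hurP.
have solve m (a a' : m.-tuple S) :
    (exists2 w : braid_word m,
       find_braid T a a' = Some (nat_braid w) &
       hurwitz_act (gsys iota a) (braid_of w) = gsys iota a') \/
    find_braid T a a' = None /\ ~ equivp R a a'.
  case found: (find_braid T a a') => [w|]; [left|right]; last first.
    by split=> // /(find_braid_complete Tall homP).
  have [wb we] := find_braid_sound Tsound found.
  rewrite size_tuple in wb; have [w' w'E] := nat_braid_onto wb.
  exists w'; rewrite ?w'E //.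
  by apply: val_inj; rewrite /= hurwitz_act_seq w'E.
have equivp_hurwitz m (a a' : m.-tuple S) :
    equivp R a a' -> hurwitz_equiv (gsys iota a) (gsys iota a').
  by case: (solve m a a') => [[w _ aw]|[_ //]]; exists (braid_of w).
have hurwitz_equivp (inj : injective (@nat_map S R G iota)) m
    (a a' : m.-tuple S) : hurwitz_equiv (gsys iota a) (gsys iota a') ->
    equivp R a a'.
  by move/hurwitz_equiv_coxeter/(coxeter_equivp presP inj).
split.
- exact: equivp_hurwitz.
- split=> [m a a' /reverses_equivp|]; first exact: equivp_hurwitz.
  have odflt_comp : computable (odflt ([::] : seq (signed nat))).
    (* The code of [Some w] is that of the list with [w] as only entry, and the
       head of the empty list is [0], the code of the empty word. *)
    exists code_head; first exact: recursive_code_head.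
    by case=> [w|//]; exact: code_head_cons.
  have [F Frec FE] := computable_partial_recursive
    (computable_app odflt_comp (computable_find_braid T)).
  exists F => // m a a' /reverses_equivp equ.
  case: (solve m a a') => [[w fw aw]|[_ //]]; exists w => //.
  by have := FE (tval a) (tval a'); rewrite /= fw /= pickle_nat_braid.
- move=> inj m a a'; split; first exact: hurwitz_equiv_coxeter.
  by move/(coxeter_equivp presP inj); exact: equivp_hurwitz.
- move=> inj compl; split=> [m a a'|].
    by split=> [/(hurwitz_equivp inj)/compl|/compl/equivp_hurwitz].
  have [F Frec FE] := computable_partial_recursive (computable_find_braid T).
  exists F => // m a a'; have := FE (tval a) (tval a').
  case: (solve m a a') => [[w -> aw]|[-> nequ]] Fp.
    exists (Some w) => //; move: Fp; congr F.
    by congr CodeSeq.code; rewrite /= pickle_nat_braid.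
  by exists None => // /(hurwitz_equivp inj).
Qed.
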